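(* Fix $p,q$ such that either $p=q\in[2,\infty)$, or $q=2$ and $p\in(1,\infty)$. Let $X,Y\in\mathcal{D}_p[l^q]$, and let $\mu:[0,1]\to\mathcal{D}_p[l^q]$ be a geodesic from $X$ to $Y$. Then there exists a convex-combination geodesic $\gamma:[0,1]\to\mathcal{D}_p[l^q]$ from $X$ to $Y$ such that for each $t\in[0,1]$ we have $d_p[l^q](\gamma(t),\mu(t))=0$.
   Context: Let $\Delta=\{(x,x):x\in\mathbb{R}\}\subset\mathbb{R}^2$ and $\mathbb{R}^2_>=\{(a,b)\in\mathbb{R}^2: b>a\}$. A persistence diagram is a countable subset of $\mathbb{R}^2_>\times\mathbb{N}$ together with countably infinitely many copies of $\Delta$ (i.e. every point of $\Delta$ is counted with countably infinite multiplicity). The $\mathbb{R}^2$-component of a point is its geometric component; the $\mathbb{N}$-component is an index that only serves to distinguish different copies of the same geometric point, so that a diagram encodes a multiset in $\mathbb{R}^2$. The set of all persistence diagrams is $\mathcal{D}$. The empty diagram $\varnothing$ consists only of the diagonal with countably infinite multiplicity. For points $x,y$ of diagrams, $\|x-y\|_q$ denotes the $q$-norm in $\mathbb{R}^2$ of the difference of their geometric components (the index is ignored). For $p\in[1,\infty)$, $q\in[1,\infty]$, $X,Y\in\mathcal{D}$ and a bijection $\varphi:X\to Y$ (all diagonal copies included), put $C_p[l^q](\varphi)=\left(\sum_{x\in X}\|x-\varphi(x)\|_q^p\right)^{1/p}$. Define $d_p[l^q](X,Y)=\inf\{C_p[l^q](\varphi): \varphi:X\to Y \text{ a bijection}\}\in[0,\infty]$;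 a bijection attaining the infimum is called optimal. Let $\mathcal{D}_p[l^q]=\{X\in\mathcal{D}: d_p[l^q](X,\varnothing)<\infty\}$. A geodesic in $\mathcal{D}_p[l^q]$ is a continuous map $\gamma:[0,1]\to\mathcal{D}_p[l^q]$ with $d_p[l^q](\gamma(s),\gamma(t))=|t-s|\,d_p[l^q](\gamma(0),\gamma(1))$ for all $s,t\in[0,1]$; it is a geodesic from $\gamma(0)$ to $\gamma(1)$. A convex-combination geodesic from $X$ to $Y$ is a geodesic of the form $\gamma(0)=X$, $\gamma(1)=Y$, $\gamma(t)=\{(1-t)x+t\varphi(x):x\in X\}$ for $t\in(0,1)$, where $\varphi:X\to Y$ is an optimal bijection; here $\gamma(t)$ is understood as a multiset of geometric points (diagonal with countably infinite multiplicity), the choice of indexing coordinates being immaterial since $d_p[l^q]$ ignores them. *)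

(* Defs.v *)
From HB Require Import structures.
From mathcomp Require Import all_boot all_order all_algebra.
From mathcomp Require Import all_classical all_reals all_analysis.
Set Implicit Arguments.
Unset Strict Implicit.
Unset Printing Implicit Defensive.
Import Order.TTheory GRing.Theory Num.Theory.
Import numFieldNormedType.Exports.
Local Open Scope classical_set_scope.
Local Open Scope card_scope.
Local Open Scope ring_scope.

Section PersistenceDiagrams.
Context {R : realType}.

(* A point of the plane together with an index telling apart the copies of a
   same geometric point. *)
Definition ipoint : Type := ((R * R) * nat)%type.

Definition above_diag : set ipoint := [set x | x.1.1 < x.1.2].

(* Countably infinitely many copies of the diagonal. *)
Definition diag_copies : set ipoint := [set x | x.1.1 = x.1.2].

(* A diagram is recorded by its off-diagonal part alone: the copies of the
   diagonal are the same for all diagrams and are put back by [points]. *)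
Record diagram := Diagram {
  offdiag :> set ipoint;
  offdiag_countable : countable offdiag;
  offdiag_above : offdiag `<=` above_diag }.

Definition points (X : diagram) : set ipoint := offdiag X `|` diag_copies.

Definition empty_diagram : diagram :=
  Diagram (countable0 ipoint) (@sub0set _ above_diag).

(* The q-norm on the plane for q in [1, +oo]; the value at -oo is junk. *)
Definition qnorm (q : \bar R) (u : R * R) : R :=
  match q with
  | r%:E => (`|u.1| `^ r + `|u.2| `^ r) `^ r^-1
  | +oo%E => Num.max `|u.1| `|u.2|
  | -oo%E => 0
  end.

(* [phi] matters only on [points X]; the sum ranges over the uncountable set
   [points X], as a supremum of finite partial sums. *)
Definition cost (p : R) (q : \bar R) (X : diagram) (phi : ipoint -> ipoint)
    : \bar R :=
  ((\esum_(x in points X) (qnorm q (x.1 - (phi x).1) `^ p)%R%:E) `^ p^-1)%E.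

Definition dist (p : R) (q : \bar R) (X Y : diagram) : \bar R :=
  ereal_inf [set cost p q X phi | phi in set_bij (points X) (points Y)].

Definition optimal (p : R) (q : \bar R) (X Y : diagram)
    (phi : ipoint -> ipoint) : Prop :=
  set_bij (points X) (points Y) phi /\ cost p q X phi = dist p q X Y.

Definition finite_diagrams (p : R) (q : \bar R) : set diagram :=
  [set X | (dist p q X empty_diagram < +oo)%E].

(* Paths are functions on R of which only the restriction to [0, 1] matters.
   The second clause is continuity for the topology of the pseudometric
   [dist p q]. *)
Definition geodesic (p : R) (q : \bar R) (g : R -> diagram) : Prop :=
  [/\ forall t : R, 0 <= t <= 1 -> finite_diagrams p q (g t),
      forall t : R, 0 <= t <= 1 ->
        dist p q (g s) (g t) @[s --> within `[0, 1] (nbhs t)] --> 0%E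
    & forall s t : R, 0 <= s <= 1 -> 0 <= t <= 1 ->
        dist p q (g s) (g t) = (`|t - s|%R%:E * dist p q (g 0%R) (g 1%R))%E].

Definition geodesic_from_to (p : R) (q : \bar R) (X Y : diagram)
    (g : R -> diagram) : Prop :=
  [/\ geodesic p q g, g 0 = X & g 1 = Y].

Definition convex_comb (t : R) (x y : R * R) : R * R :=
  ((1 - t) * x.1 + t * y.1, (1 - t) * x.2 + t * y.2).

(* [Z] and the family of the (1 - t) x + t (phi x), x in [points X], are the
   same multiset off the diagonal: every geometric point has the same
   multiplicity in both. On the diagonal nothing is asked, as all
   multiplicities are countably infinite by convention. *)
Definition is_convex_comb (X : diagram) (phi : ipoint -> ipoint) (t : R)
    (Z : diagram) : Prop :=
  forall z : R * R, z.1 < z.2 ->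
    [set w | points Z w /\ w.1 = z] #=
    [set x | points X x /\ convex_comb t x.1 (phi x).1 = z].

Definition convex_comb_geodesic (p : R) (q : \bar R) (X Y : diagram)
    (g : R -> diagram) : Prop :=
  geodesic_from_to p q X Y g /\
  exists2 phi : ipoint -> ipoint, optimal p q X Y phi &
    forall t : R, 0 < t < 1 -> is_convex_comb X phi t (g t).

End PersistenceDiagrams.

Arguments ipoint : clear implicits.
Arguments diagram : clear implicits.

(* Main.v *)
Require Import Defs.
From mathcomp Require Import all_boot all_order all_algebra.
From mathcomp Require Import all_classical all_reals all_analysis.
From mathcomp Require Import ring lra.
Set Implicit Arguments.
Unset Strict Implicit.
Unset Printing Implicit Defensive.
Import Order.TTheory GRing.Theory Num.Theory.
Import numFieldNormedType.Exports.
Local Open Scope classical_set_scope.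
Local Open Scope ring_scope.

(* The geodesic mu is itself a convex-combination geodesic, so gamma := mu.

   For finitely many times 0 < t_1 < ... < t_n < 1, compose optimal bijections
   mu 0 -> mu t_1 -> ... -> mu 1.  Since v |-> |v|_q^p is strictly convex,
   optimality of the composite phi_T forces each point to travel at constant
   speed on a segment, so mu t_i is the multiset of convex combinations along
   phi_T.

   The matchings phi_T are indexed by the directed set of finite sets T of
   times; take an ultrafilter on it.  Diagrams of finite cost have finitely
   many points at distance >= e from the diagonal, so along the ultrafilter
   each off-diagonal point either keeps the same off-diagonal partner or has
   partners converging to a point of the diagonal.  This defines a limit
   bijection phi, optimal by lower semicontinuity of the cost, and local
   finiteness of mu t shows that multiplicities pass to the limit.  The same
   compactness gives the existence of optimal bijections. *)

(** * Strict convexity and continuity of real powers *)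

Lemma bernoulli_powR (R : realType) (p x : R) :
  1 < p -> 0 <= x -> x != 1 -> 1 + p * (x - 1) < x `^ p.
Proof.
move=> p1 x0 x1; have [->|xn0] := eqVneq x 0.
  by rewrite powR0 ?gt_eqF ?(lt_trans ltr01)//; lra.
have xp : 0 < x by rewrite lt_def xn0.
have ln0 : ln x != 0.
  by apply: contra x1 => /eqP l0; rewrite -(lnK xp) l0 expR0.
rewrite /powR (negbTE xn0).
(* This splits x^p as x exp((p - 1) ln x). The bound e^y > 1 + y for nonzero y, taken at y = - ln x
   and at y = (p - 1) ln x, then gives the claim. *)
have -> : p * ln x = ln x + (p - 1) * ln x by ring.
rewrite expRD lnK//.
have A : 1 - ln x < x^-1.
  by rewrite -{2}(lnK xp) -expRN; apply: expR_gt1Dx; rewrite oppr_eq0.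
have B : 1 + (p - 1) * ln x < expR ((p - 1) * ln x).
  by apply: expR_gt1Dx; rewrite mulf_neq0// subr_eq0 gt_eqF.
have C : x * (1 - ln x) < 1 by rewrite mulrC -ltr_pdivlMr// mul1r.
nra.
Qed.

(** Bernoulli's inequality at a / m, multiplied by m^p. *)
Lemma powR_tangent (R : realType) (p m a : R) :
  1 < p -> 0 < m -> 0 <= a -> a != m ->
  m `^ p + p * m `^ (p - 1) * (a - m) < a `^ p.
Proof.
move=> p1 m0 a0 am.
have := bernoulli_powR p1 (divr_ge0 a0 (ltW m0)).
have amn : a / m != 1.
  by apply: contra am => /eqP h; rewrite -[a](divfK (lt0r_neq0 m0)) h mul1r.
move=> /(_ amn).
have Vp : m^-1 `^ p = (m `^ p)^-1.
  by rewrite -(powR_inv1 (ltW m0)) powRAC powR_inv1 ?powR_ge0.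
rewrite powRM ?invr_ge0 ?(ltW m0)// Vp ltr_pdivlMr ?powR_gt0// => h.
apply: le_lt_trans h.
have E : m * m `^ (p - 1) = m `^ p by rewrite mulr_powRB1 ?(ltW m0)// (lt_trans ltr01).
rewrite -E le_eqVlt; apply/orP; left; apply/eqP.
by have := lt0r_neq0 m0; move: (m `^ _) => w hm; field.
Qed.

(** The tangent inequalities at the mean m are added with weights l and 1 - l; the linear terms
    cancel. *)
Lemma powR_strictly_convex (R : realType) (p l a b : R) :
  1 < p -> 0 < l < 1 -> 0 <= a -> 0 <= b -> a != b ->
  (l * a + (1 - l) * b) `^ p < l * a `^ p + (1 - l) * b `^ p.
Proof.
move=> p1 /andP[l0 l1] a0 b0 ab.
set m := l * a + (1 - l) * b.
have m0 : 0 < m.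
  have [aE|] := eqVneq a 0.
    have : b != 0 by rewrite -aE eq_sym.
    by rewrite /m => bn; have : 0 < b; [rewrite lt_def bn | nra].
  by rewrite /m => an; have : 0 < a; [rewrite lt_def an | nra].
have am : a != m.
  apply: contra ab => /eqP am; have : (1 - l) * (a - b) = 0.
    by transitivity (a - m); [rewrite /m; ring | rewrite -am subrr].
  by move/eqP; rewrite mulf_eq0 subr_eq0 (gt_eqF l1)/= subr_eq0.
have bm : b != m.
  apply: contra ab => /eqP bm; have : l * (b - a) = 0.
    by transitivity (b - m); [rewrite /m; ring | rewrite -bm subrr].
  by move/eqP; rewrite mulf_eq0 (gt_eqF l0)/= subr_eq0 eq_sym.
have := powR_tangent p1 m0 a0 am.
have := powR_tangent p1 m0 b0 bm.
have : l * (a - m) + (1 - l) * (b - m) = 0 by rewrite /m; ring.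
move: (p * m `^ (p - 1)) (m `^ p) (a `^ p) (b `^ p) => k mp ap bp E h1 h2.
have : k * (l * (a - m) + (1 - l) * (b - m)) = 0 by rewrite E mulr0.
nra.
Qed.

Lemma powR_convex (R : realType) (p l a b : R) :
  1 < p -> 0 < l < 1 -> 0 <= a -> 0 <= b ->
  (l * a + (1 - l) * b) `^ p <= l * a `^ p + (1 - l) * b `^ p.
Proof.
move=> p1 l01 a0 b0; have [->|ab] := eqVneq a b.
  by rewrite -!mulrDl addrC subrK !mul1r.
exact/ltW/powR_strictly_convex.
Qed.

(** If the absolute values differ, the power is strictly convex; if they agree, then a = - b is
    nonzero and the triangle inequality is strict. *)
Lemma normr_powR_strictly_convex (R : realType) (p l a b : R) :
  1 < p -> 0 < l < 1 -> a != b ->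
  `|l * a + (1 - l) * b| `^ p < l * `|a| `^ p + (1 - l) * `|b| `^ p.
Proof.
move=> p1 l01 ab; have /andP[l0 l1] := l01.
have p0 : 0 < p by exact: lt_trans p1.
have tri : `|l * a + (1 - l) * b| <= l * `|a| + (1 - l) * `|b|.
  rewrite (le_trans (ler_normD _ _))// !normrM (gtr0_norm l0).
  by rewrite (gtr0_norm (_ : 0 < 1 - l)) ?subr_gt0.
have s0 : 0 <= l * `|a| + (1 - l) * `|b| by apply: le_trans tri.
have [nab|nab] := eqVneq `|a| `|b|; last first.
  apply: le_lt_trans (powR_strictly_convex p1 l01 (normr_ge0 a) (normr_ge0 b) nab).
  by apply: ge0_ler_powR; rewrite ?nnegrE ?(ltW p0).
apply: lt_le_trans (powR_convex p1 l01 (normr_ge0 a) (normr_ge0 b)).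
rewrite (gt0_ltr_powR p0) ?nnegrE//.
have ba : a = - b.
  by move/eqP: nab; rewrite eqr_norm2 (negbTE ab)/= => /eqP.
have bn : b != 0 by apply: contra ab; rewrite ba => /eqP ->; rewrite oppr0.
rewrite ba normrN -mulrDl (addrC l) subrK mul1r mulrN -mulNr -mulrDl normrM.
rewrite -{2}[`|b|]mul1r ltr_pM2r ?normr_gt0//.
by rewrite ltr_norml; apply/andP; split; lra.
Qed.

Lemma normr_powR_convex (R : realType) (p l a b : R) :
  1 < p -> 0 < l < 1 ->
  `|l * a + (1 - l) * b| `^ p <= l * `|a| `^ p + (1 - l) * `|b| `^ p.
Proof.
move=> p1 l01; have [->|ab] := eqVneq a b.
  by rewrite -!mulrDl addrC subrK !mul1r.
exact/ltW/normr_powR_strictly_convex.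
Qed.

(** Near a positive limit the power is exp(p ln), hence continuous. At the limit 0 the logarithm
    breaks down, and e^(1/p) serves as the modulus. *)
Lemma cvg_powR (R : realType) (I : Type) (U : set_system I) (FU : Filter U)
    (p a : R) (f : I -> R) :
  0 < p -> 0 <= a -> (forall i, 0 <= f i) ->
  f i @[i --> U] --> a -> f i `^ p @[i --> U] --> a `^ p.
Proof.
move=> p0 a0 f0 fa; move: a0; rewrite le_eqVlt => /predU1P[aE|a0].
  rewrite -aE powR0 ?gt_eqF//; apply/cvgrPdist_lt => e e0.
  move/cvgrPdist_lt: fa => /(_ (e `^ p^-1) (powR_gt0 _ e0)).
  rewrite -aE; apply: filterS => i; rewrite !sub0r !normrN !ger0_norm ?powR_ge0//.
  move=> h; rewrite -[ltRHS](powRr1 (ltW e0)) -[X in e `^ X](mulVf (lt0r_neq0 p0)) powRrM.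
  by apply: (gt0_ltr_powR p0); rewrite ?nnegrE ?powR_ge0.
have H : expR (p * ln (f i)) @[i --> U] --> expR (p * ln a).
  apply: (@continuous_cvg _ _ _ U FU (fun i => p * ln (f i)) (@expR R)).
    exact: continuous_expR.
  apply: cvgMr; apply: (@continuous_cvg _ _ _ U FU f (@ln R)) => //.
  exact: continuous_ln.
rewrite {2}/powR gt_eqF//; apply: cvg_trans H; apply: near_eq_cvg.
move/cvgr_gt : fa => /(_ 0 a0); apply: filterS => i fi.
by rewrite /powR gt_eqF.
Qed.

(** * The p-th power of the q-norm and its strict convexity *)

Definition gauge (R : realType) (p : R) (q : \bar R) (v : R * R) : R :=
  qnorm q v `^ p.

Definition admissible (R : realType) (p : R) (q : \bar R) : Prop :=
  (q = p%:E /\ 2 <= p) \/ (q = 2%:E /\ 1 < p).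

Section Gauge.
Context (R : realType) (p : R) (q : \bar R).
Implicit Types u v : R * R.

Lemma gauge_ge0 v : 0 <= gauge p q v.
Proof. exact: powR_ge0. Qed.

Lemma gaugepp v : 0 < p -> gauge p p%:E v = `|v.1| `^ p + `|v.2| `^ p.
Proof.
move=> p0; rewrite /gauge /= -powRrM mulVf ?gt_eqF// powRr1//.
Qed.

Lemma gauge2 v : gauge p 2%:E v = Num.sqrt (v.1 ^+ 2 + v.2 ^+ 2) `^ p.
Proof.
rewrite /gauge /= powR12_sqrt ?addr_ge0 ?powR_ge0//.
by rewrite !powR_mulrn ?normr_ge0// !real_normK ?num_real.
Qed.

Lemma gaugeN v : gauge p q (- v) = gauge p q v.
Proof.
have e1 : `|(- v).1| = `|v.1| by exact: normrN.
have e2 : `|(- v).2| = `|v.2| by exact: normrN.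
by rewrite /gauge /qnorm e1 e2.
Qed.

Hypothesis adm : admissible p q.

Lemma admissible_gt1 : 1 < p.
Proof. by case: adm => [[_ p2]|[]//]; apply: lt_le_trans p2; rewrite ltr1n. Qed.

Lemma admissible_gt0 : 0 < p.
Proof. exact: lt_trans admissible_gt1. Qed.

Let p1 := admissible_gt1.
Let p0 := admissible_gt0.

Lemma gauge_scale (k : R) v : 0 <= k ->
  gauge p q (k * v.1, k * v.2) = k `^ p * gauge p q v.
Proof.
move=> k0; case: adm => [[-> _]|[-> _]].
  by rewrite !gaugepp//= !normrM (ger0_norm k0) !powRM// mulrDr.
rewrite !gauge2/= !exprMn -mulrDr sqrtrM ?sqr_ge0// sqrtr_sqr (ger0_norm k0).
by rewrite powRM ?sqrtr_ge0.
Qed.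

Lemma gauge_coord v : `|v.1| `^ p <= gauge p q v /\ `|v.2| `^ p <= gauge p q v.
Proof.
case: adm => [[-> _]|[-> _]].
  by rewrite gaugepp//; split; rewrite ?lerDl ?lerDr powR_ge0.
rewrite gauge2 -!sqrtr_sqr; split; apply: ge0_ler_powR;
  rewrite ?nnegrE ?sqrtr_ge0 ?(ltW p0)// ler_wsqrtr//.
  by rewrite lerDl sqr_ge0.
by rewrite lerDr sqr_ge0.
Qed.

Lemma gauge0 : gauge p q 0 = 0.
Proof.
have := @gauge_scale 0 0 (lexx 0); rewrite !mul0r powR0 ?gt_eqF// mul0r.
by [].
Qed.

Lemma gauge_cvg (I : Type) (U : set_system I) (FU : Filter U) (f g : I -> R) a b :
  f i @[i --> U] --> a -> g i @[i --> U] --> b ->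
  gauge p q (f i, g i) @[i --> U] --> gauge p q (a, b).
Proof.
move=> fa gb; case: adm => [[-> _]|[-> _]].
  rewrite gaugepp//=; under eq_cvg do rewrite gaugepp//=.
  by apply: cvgD; apply: cvg_powR => //; exact: cvg_norm.
rewrite gauge2; under eq_cvg do rewrite gauge2.
apply: (cvg_powR FU p0); [exact: sqrtr_ge0 | by move=> i; exact: sqrtr_ge0 |].
rewrite /=.
apply: (@continuous_cvg _ _ _ U FU _ (@Num.sqrt R)); first exact: sqrt_continuous.
by rewrite !expr2; under eq_cvg do rewrite !expr2; apply: cvgD; apply: cvgM.
Qed.

Let dot u v := u.1 * v.1 + u.2 * v.2.
Let eucl u := Num.sqrt (u.1 ^+ 2 + u.2 ^+ 2).

Let eucl_sqr u : eucl u ^+ 2 = u.1 ^+ 2 + u.2 ^+ 2.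
Proof. by rewrite sqr_sqrtr// addr_ge0 ?sqr_ge0. Qed.

Let dot_le u v : dot u v <= eucl u * eucl v.
Proof.
have [d0|d0] := leP (dot u v) 0; first by rewrite (le_trans d0)// mulr_ge0 ?sqrtr_ge0.
rewrite -ler_sqr ?nnegrE ?mulr_ge0 ?sqrtr_ge0 ?(ltW d0)// exprMn !eucl_sqr /dot.
(* Lagrange's identity: the defect in the Cauchy-Schwarz inequality is the square of the determinant
   of u and v. *)
rewrite -subr_ge0 [leRHS](_ : _ = (u.1 * v.2 - u.2 * v.1) ^+ 2) ?sqr_ge0//; ring.
Qed.

Let eucl_comb t u v : 0 < t < 1 ->
  eucl (convex_comb t u v) <= (1 - t) * eucl u + t * eucl v.
Proof.
move=> /andP[t0 t1]; have u0 : 0 <= eucl u := sqrtr_ge0 _.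
have v0 : 0 <= eucl v := sqrtr_ge0 _.
rewrite -ler_sqr ?nnegrE ?sqrtr_ge0//; last by nra.
rewrite eucl_sqr/=.
have := dot_le u v; have := eucl_sqr u; have := eucl_sqr v; rewrite /dot.
move: (eucl u) (eucl v) => a b hb ha hd.
have : (1 - t) * t * (u.1 * v.1 + u.2 * v.2) <= (1 - t) * t * (a * b).
  by rewrite ler_wpM2l// mulr_ge0// ?subr_ge0 ltW.
move=> hk; rewrite [leLHS](_ : _ = (1 - t) ^+ 2 * (u.1 ^+ 2 + u.2 ^+ 2) +
  t ^+ 2 * (v.1 ^+ 2 + v.2 ^+ 2) + 2 * ((1 - t) * t * (u.1 * v.1 + u.2 * v.2))); last by ring.
rewrite [leRHS](_ : _ = (1 - t) ^+ 2 * a ^+ 2 + t ^+ 2 * b ^+ 2 +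
  2 * ((1 - t) * t * (a * b))); last by ring.
rewrite ha hb; lra.
Qed.

(** For q = p the gauge is a sum over the coordinates, and a coordinate in which u and v differ
    gives strictness. For q = 2, either the Euclidean norms differ and the power is strictly convex,
    or they agree and the Euclidean ball is strictly convex. *)
Lemma gauge_strictly_convex t u v : 0 < t < 1 -> u != v ->
  gauge p q (convex_comb t u v) < (1 - t) * gauge p q u + t * gauge p q v.
Proof.
move=> t01 uv; have t01' : 0 < 1 - t < 1.
  by case/andP: t01 => t0 t1; apply/andP; split; lra.
have comb x y : (1 - t) * x + t * y = (1 - t) * x + (1 - (1 - t)) * y.
  by rewrite opprB addrCA subrr addr0.
case: adm => [[-> _]|[-> _]].
  rewrite !gaugepp//= !comb.
  have [u1|u1] := eqVneq u.1 v.1.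
    have u2 : u.2 != v.2.
      apply: contra uv => /eqP u2; apply/eqP.
      by rewrite [u]surjective_pairing u1 u2 -surjective_pairing.
    have := normr_powR_strictly_convex p1 t01' u2.
    have := normr_powR_convex u.1 v.1 p1 t01'.
    lra.
  have := normr_powR_strictly_convex p1 t01' u1.
  have := normr_powR_convex u.2 v.2 p1 t01'.
  lra.
have mono := @ge0_ler_powR R p (ltW p0).
have smono := gt0_ltr_powR p0.
rewrite !gauge2.
have [nuv|nuv] := eqVneq (eucl u) (eucl v); last first.
  rewrite comb; apply: le_lt_trans (powR_strictly_convex p1 t01' (sqrtr_ge0 _) (sqrtr_ge0 _) nuv).
  apply: mono; rewrite ?nnegrE ?sqrtr_ge0//.
    by rewrite -comb (le_trans _ (eucl_comb _ _ t01))// sqrtr_ge0.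
  by rewrite -comb; exact: eucl_comb.
rewrite -![Num.sqrt (_ ^+ 2 + _ ^+ 2)]/(eucl _) nuv -mulrDl subrK mul1r.
apply: smono; rewrite ?nnegrE ?sqrtr_ge0//.
rewrite -ltr_sqr ?nnegrE ?sqrtr_ge0// !eucl_sqr/=.
have : u.1 ^+ 2 + u.2 ^+ 2 = v.1 ^+ 2 + v.2 ^+ 2 by rewrite -!eucl_sqr nuv.
have : 0 < (u.1 - v.1) ^+ 2 + (u.2 - v.2) ^+ 2.
  rewrite lt_def addr_ge0 ?sqr_ge0// andbT paddr_eq0 ?sqr_ge0// !sqrf_eq0 !subr_eq0.
  apply: contra uv => /andP[/eqP u1 /eqP u2].
  by rewrite [u]surjective_pairing u1 u2 -surjective_pairing.
have /andP[t0 t1] := t01.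
move=> d0 e.
have : 0 < t * (1 - t) * ((u.1 - v.1) ^+ 2 + (u.2 - v.2) ^+ 2).
  by rewrite !mulr_gt0// subr_gt0.
(* The squared norm of the combination falls short of the mean of the squared norms by t (1 - t) |u
   - v|^2. *)
have -> : ((1 - t) * u.1 + t * v.1) ^+ 2 + ((1 - t) * u.2 + t * v.2) ^+ 2 =
  (1 - t) * (u.1 ^+ 2 + u.2 ^+ 2) + t * (v.1 ^+ 2 + v.2 ^+ 2)
  - t * (1 - t) * ((u.1 - v.1) ^+ 2 + (u.2 - v.2) ^+ 2) by ring.
rewrite e; lra.
Qed.

(** Think of u and v as displacements over durations a and b. This is strict convexity at the
    velocities u / a and v / b, with weights a / (a + b) and b / (a + b), rescaled by homogeneity of
    degree p. Equality means equal velocities, written without division. *)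
Lemma gauge_add (a b : R) u v : 0 < a -> 0 < b ->
  gauge p q (u + v) / (a + b) `^ p <=
    a / (a + b) * (gauge p q u / a `^ p) + b / (a + b) * (gauge p q v / b `^ p)
    ?= iff (b * u.1 == a * v.1) && (b * u.2 == a * v.2).
Proof.
move=> a0 b0; have ab0 : 0 < a + b by rewrite addr_gt0.
pose t := b / (a + b).
have t01 : 0 < t < 1.
  by rewrite divr_gt0//= ltr_pdivrMr// mul1r ltrDr.
have ta : 1 - t = a / (a + b) by rewrite /t; field; rewrite gt_eqF.
pose U := (a^-1 * u.1, a^-1 * u.2); pose V := (b^-1 * v.1, b^-1 * v.2).
have Vp x : 0 < x -> (x `^ p)^-1 = x^-1 `^ p.
  by move=> x0; rewrite -(powR_inv1 (ltW x0)) powRAC powR_inv1 ?powR_ge0.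
have gU : gauge p q u / a `^ p = gauge p q U.
  by rewrite gauge_scale ?invr_ge0 ?(ltW a0)// Vp// mulrC.
have gV : gauge p q v / b `^ p = gauge p q V.
  by rewrite gauge_scale ?invr_ge0 ?(ltW b0)// Vp// mulrC.
have gUV : gauge p q (u + v) / (a + b) `^ p = gauge p q (convex_comb t U V).
  rewrite Vp// mulrC -gauge_scale ?invr_ge0 ?(ltW ab0)//; congr gauge.
  rewrite /convex_comb ta /t/= /U /V/=.
  by congr pair; field; rewrite !gt_eqF.
rewrite gU gV gUV -ta -/t.
have eqUV : ((b * u.1 == a * v.1) && (b * u.2 == a * v.2)) = (U == V).
  have c x y : (b * x == a * y) = (a^-1 * x == b^-1 * y).
    by rewrite (mulrC a^-1) (mulrC b^-1) eqr_div ?lt0r_neq0// (mulrC x) (mulrC y).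
  by rewrite !c /U /V; apply/andP/eqP => [[/eqP -> /eqP ->]//|[-> ->]].
rewrite eqUV; have [<-|UV] := eqVneq U V.
  rewrite -mulrDl subrK mul1r /convex_comb -!mulrDl subrK !mul1r.
  by rewrite -surjective_pairing; split; rewrite ?lexx ?eqxx.
have lt := gauge_strictly_convex t01 UV.
by split; [exact: ltW | rewrite lt_eqF].
Qed.

End Gauge.

(** * Costs through finite partial sums *)

Definition total_cost_le (R : realType) (p : R) (q : \bar R) (A : diagram R)
    (phi : ipoint R -> ipoint R) (c : R) : Prop :=
  forall s : seq (ipoint R), uniq s -> (forall x, x \in s -> points A x) ->
    \sum_(x <- s) gauge p q (x.1 - (phi x).1) <= c.

Lemma esum_leP (R : realType) (T : choiceType) (S : set T) (f : T -> R) (c : R) :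
  (\esum_(x in S) (f x)%:E <= c%:E)%E <->
  (forall s : seq T, uniq s -> (forall x, x \in s -> S x) ->
    \sum_(x <- s) f x <= c).
Proof.
split=> [h s us sS|h].
  rewrite -lee_fin -sumEFin; apply: le_trans h.
  apply: esum_ge; exists [set` s]; last by rewrite fsbig_seq.
  by split; [exact: finite_seq | move=> x /=; exact: sS].
apply: ge_ereal_sup => _ [F [finF FS] <-].
rewrite fsbig_finite//= sumEFin lee_fin; apply: h => [|x]; first exact: finmap.fset_uniq.
move=> xF; apply: FS.
by apply: set_mem; rewrite -(in_fset_set finF).
Qed.

Lemma total_cost_le_total (R : realType) (p : R) (q : \bar R) (A : diagram R)
    (phi : ipoint R -> ipoint R) (c d : R) :
  c <= d -> total_cost_le p q A phi c -> total_cost_le p q A phi d.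
Proof. by move=> cd h s us sA; apply: le_trans cd; exact: h. Qed.

(** With p-th powers taken on both sides, later estimates concern finite sums of reals in place of
    an extended real sum over an uncountable set. *)
Lemma cost_leP (R : realType) (p : R) (q : \bar R) (A : diagram R)
    (phi : ipoint R -> ipoint R) (c : R) : 0 < p -> 0 <= c ->
  (cost p q A phi <= c%:E)%E <-> total_cost_le p q A phi (c `^ p).
Proof.
move=> p0 c0.
rewrite /total_cost_le; rewrite -(esum_leP _ (fun x : ipoint R => gauge p q (x.1 - (phi x).1))).
rewrite /cost; set E := (\esum_(_ in _) _)%E.
have E0 : (0 <= E)%E by apply: esum_ge0 => x _; rewrite lee_fin powR_ge0.
have inI (x : \bar R) : (0 <= x)%E -> x \in `[0%E, +oo%E] by move=> x0; rewrite in_itv/= x0 leey.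
split=> h.
  have := gt0_ler_poweR (ltW p0) (inI _ (poweR_ge0 E p^-1)) (inI c%:E c0) h.
  by rewrite /= -poweRrM mulVf ?gt_eqF// poweRe1// poweR_EFin.
have pV0 : 0 <= p^-1 by rewrite invr_ge0 ltW.
have := gt0_ler_poweR pV0 (inI _ E0) (inI (c `^ p)%:E (powR_ge0 c p)) h.
by rewrite /= -powRrM divff ?gt_eqF// powRr1.
Qed.

Lemma cost_ge0 (R : realType) (p : R) (q : \bar R) (A : diagram R)
    (phi : ipoint R -> ipoint R) : (0 <= cost p q A phi)%E.
Proof. exact: poweR_ge0. Qed.

Lemma dist_ge0 (R : realType) (p : R) (q : \bar R) (A B : diagram R) :
  (0 <= dist p q A B)%E.
Proof. by apply/ereal_infP => _ [phi _ <-]; exact: cost_ge0. Qed.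

Lemma dist_lt (R : realType) (p : R) (q : \bar R) (A B : diagram R) (c : R) :
  0 < p -> (dist p q A B < c%:E)%E ->
  exists2 phi, set_bij (points A) (points B) phi &
    total_cost_le p q A phi (c `^ p).
Proof.
move=> p0 h; have c0 : 0 <= c by rewrite -lee_fin ltW// (le_lt_trans _ h)// dist_ge0.
have [_ [phi bij <-] /ltW/(cost_leP _ _ _ p0 c0) le] := ereal_inf_lt h.
by exists phi.
Qed.

Lemma dist_le (R : realType) (p : R) (q : \bar R) (A B : diagram R)
    (phi : ipoint R -> ipoint R) (c : R) : 0 < p -> 0 <= c ->
  set_bij (points A) (points B) phi -> total_cost_le p q A phi (c `^ p) ->
  (dist p q A B <= c%:E)%E.
Proof.
move=> p0 c0 bij /(cost_leP _ _ _ p0 c0); apply: le_trans.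
by apply: ereal_inf_lbound; exists phi.
Qed.

(** * Persistence and local finiteness of diagrams *)

Definition pers (R : realType) (x : R * R) : R := x.2 - x.1.

Definition locally_finite (R : realType) (A : diagram R) : Prop :=
  forall e : R, 0 < e -> finite_set [set x : ipoint R | offdiag A x /\ e <= pers x.1].

(** A bijection of finite cost onto the empty diagram sends a point of persistence at least e to the
    diagonal, so some coordinate moves by at least e / 2 and the point costs at least (e / 2)^p.
    Only finitely many such points fit into the total cost. *)
Lemma finite_diagrams_locally_finite (R : realType) (p : R) (q : \bar R)
    (A : diagram R) : admissible p q ->
  finite_diagrams p q A -> locally_finite A.
Proof.
move=> adm finA e e0; have p0 := admissible_gt0 adm.
have [c [c0 hc]] : exists c : R, 0 <= c /\ (dist p q A (empty_diagram (R:=R)) < c%:E)%E.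
  move: finA (dist_ge0 p q A (empty_diagram (R:=R))); rewrite /finite_diagrams/=.
  case: (dist _ _ _ _) => [r| |]//; rewrite lee_fin => _ r0.
  by exists (r + 1); rewrite addr_ge0// lte_fin ltrDl.
have [phi [phiA _ _] le] := dist_lt p0 hc.
set S := [set x | _ /\ _]; apply: contrapT => /infinite_set_fset inf.
pose d := (e / 2) `^ p; have d0 : 0 < d by rewrite powR_gt0// divr_gt0.
have Sd x : S x -> d <= gauge p q (x.1 - (phi x).1).
  case=> Ax ex; have : points A x by left.
  move=> /phiA; case=> [[]|]; rewrite /diag_copies/= => diag.
  have [h1 h2] := gauge_coord adm (x.1 - (phi x).1).
  have mono y : e / 2 <= `|y| -> d <= `|y| `^ p.
    by move=> ?; apply: (ge0_ler_powR (ltW p0)); rewrite ?nnegrE ?divr_ge0// ltW.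
  have [a|a] := leP (e / 2) `|(x.1 - (phi x).1).1|.
    by apply: le_trans h1; exact: mono.
  apply: le_trans h2; apply: mono.
  rewrite leNgt; apply/negP => b; move: a b ex; rewrite /pers /= -diag.
  by rewrite !ltr_norml => /andP[? ?] /andP[? ?] ?; lra.
pose n := Num.bound (c `^ p / d).
have [B BS nB] := inf n.
have := le (finmap.enum_fset B) (finmap.fset_uniq _) (fun x xB => or_introl (BS x xB).1).
apply/negP; rewrite -ltNge.
apply: (@lt_le_trans _ _ (n%:R * d)).
  rewrite -ltr_pdivrMr//; apply: le_lt_trans (archi_boundP _) => //.
  by rewrite divr_ge0 ?powR_ge0 ?ltW.
apply: (@le_trans _ _ (\sum_(x <- finmap.enum_fset B) d)).
  by rewrite big_const_seq count_predT iter_addr_0 -[leRHS]mulr_natl ler_wpM2r ?(ltW d0)// ler_nat.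
by rewrite !big_seq; apply: ler_sum => x xB; apply: Sd; exact: BS.
Qed.

(** * Bijections from relations and from partial matchings *)

Lemma set_bij_of_rel (T : Type) (A B : set T) (G : T -> T -> Prop) :
  (forall x, A x -> exists2 y, B y & G x y) ->
  (forall y, B y -> exists2 x, A x & G x y) ->
  (forall x y y', G x y -> G x y' -> y = y') ->
  (forall x x' y, G x y -> G x' y -> x = x') ->
  exists2 phi, set_bij A B phi & forall x, A x -> G x (phi x).
Proof.
move=> tot sur fun_ inj_.
have /choice[phi hphi] : forall x, exists y, A x -> B y /\ G x y.
  by move=> x; have [/tot[y By Gxy]|nA] := pselect (A x); [exists y | exists x].
exists phi => [|x /hphi[]//]; split.
- by move=> x /hphi[].
- move=> x x' /set_mem/hphi[_ Gx] /set_mem/hphi[_ Gx'] e.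
  by apply: inj_ Gx _; rewrite e.
- move=> y /sur[x Ax Gxy]; exists x => //.
  by have [_ Gx] := hphi x Ax; exact: fun_ Gx Gxy.
Qed.

(** Each set contains the image of n |-> 2n + 1, so Cantor-Bernstein applies. Odd numbers are the
    diagonal indices that stay free when points are parked at even indices. *)
Lemma co_even_card_eq (S S' : set nat) :
  (forall n, odd n -> S n) -> (forall n, odd n -> S' n) -> (S #= S')%card.
Proof.
have H (V W : set nat) : (forall n, odd n -> W n) -> (V #<= W)%card.
  move=> hW; apply: (card_le_trans (card_leT V)).
  apply: (card_le_trans (B := range (fun n => n.*2.+1))).
    by rewrite (card_le_eqr (inj_card_eq _)) ?card_lexx// => m n _ _ [] /double_inj.
  by apply: subset_card_le => _ [n _ <-]; apply: hW; rewrite /= odd_double.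
by move=> hS hS'; apply: Cantor_Bernstein; apply: H.
Qed.

(* Infinitely many copies of every diagonal point leave room to park the
   unmatched points of A over a and those of B over b; the remaining copies
   are matched at zero cost. *)
Lemma extend_matching (R : realType) (A B : diagram R)
    (M : ipoint R -> ipoint R -> Prop) (a b : ipoint R -> R) :
  (forall x y, M x y -> offdiag A x /\ offdiag B y) ->
  (forall x y y', M x y -> M x y' -> y = y') ->
  (forall x x' y, M x y -> M x' y -> x = x') ->
  exists2 phi, set_bij (points A) (points B) phi &
    forall x, points A x ->
      [\/ M x (phi x),
          [/\ offdiag A x, forall y, ~ M x y & (phi x).1 = (a x, a x)],
          [/\ offdiag B (phi x), forall x', ~ M x' (phi x)
            & x.1 = (b (phi x), b (phi x))]
        | [/\ diag_copies x, diag_copies (phi x) & (phi x).1 = x.1] ].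
Proof.
move=> MAB Mfun Minj.
have /countable_injP[eA eAinj] := @offdiag_countable R A.
have /countable_injP[eB eBinj] := @offdiag_countable R B.
pose uA x := offdiag A x /\ forall y, ~ M x y.
pose uB y := offdiag B y /\ forall x, ~ M x y.
(* [NA c] and [NB c] are the indices of copies of (c, c) not taken by parked points of A and of B.
   Doubling the encodings leaves all odd indices free, so [h c] can match the free source copies
   [NB c] with the free target copies [NA c]. *)
pose NA c : set nat := [set n | ~ exists2 x, uA x & a x = c /\ n = (eA x).*2].
pose NB c : set nat := [set n | ~ exists2 y, uB y & b y = c /\ n = (eB y).*2].
have /choice[h hbij] : forall c, exists h, set_bij (NB c) (NA c) h.
  move=> c; apply/card_set_bijP/co_even_card_eq => n on [y _ [_ nE]];
    by rewrite nE odd_double in on.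
pose G (x y : ipoint R) := [\/ M x y,
  uA x /\ y = ((a x, a x), (eA x).*2),
  uB y /\ x = ((b y, b y), (eB y).*2)
  | [/\ diag_copies x, y.1 = x.1, NB x.1.1 x.2 & y.2 = h x.1.1 x.2] ].
have nA x : offdiag A x -> x.1.1 <> x.1.2.
  by move/offdiag_above => + e0; rewrite /above_diag/= e0 ltxx.
have nB y : offdiag B y -> y.1.1 <> y.1.2.
  by move/offdiag_above => + e0; rewrite /above_diag/= e0 ltxx.
have MA x y : M x y -> offdiag A x by move/MAB => [].
have MB x y : M x y -> offdiag B y by move/MAB => [].
have [||||phi bij Gphi] := @set_bij_of_rel _ (points A) (points B) G.
- move=> x [Ax|dx].
    have [[y Mxy]|nM] := pselect (exists y, M x y).
      by exists y; [left; exact: MB Mxy | constructor 1].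
    have ux : uA x by split=> // y Mxy; apply: nM; exists y.
    by exists ((a x, a x), (eA x).*2); [right | constructor 2].
  have [[y uy [bc xe]]|nx] := pselect (exists2 y, uB y & b y = x.1.1 /\ x.2 = (eB y).*2).
    exists y; first by left; case: uy.
    constructor 3; split=> //; rewrite bc -xe [LHS]surjective_pairing.
    by rewrite [x.1]surjective_pairing -dx.
  by exists (x.1, h x.1.1 x.2); [right | constructor 4].
- move=> y [By|dy].
    have [[x Mxy]|nM] := pselect (exists x, M x y).
      by exists x; [left; exact: MA Mxy | constructor 1].
    have uy : uB y by split=> // x Mxy; apply: nM; exists x.
    by exists ((b y, b y), (eB y).*2); [right | constructor 3].
  have [[x ux [ac ye]]|ny] := pselect (exists2 x, uA x & a x = y.1.1 /\ y.2 = (eA x).*2).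
    exists x; first by left; case: ux.
    constructor 2; split=> //; rewrite ac -ye [LHS]surjective_pairing.
    by rewrite [y.1]surjective_pairing -dy.
  have [_ _ /(_ y.2 ny)[n Nn hn]] := hbij y.1.1.
  by exists (y.1, n); [right | constructor 4].
- move=> x y y' [Mxy|[[Ax nM] ->]|[[By nM] xE]|[dx y1 Nx y2]].
  + case=> [Mxy'|[[_ nM]]|[[By' nM] xE]|[dx _ _ _]].
    * exact: Mfun Mxy Mxy'.
    * by have := nM _ Mxy.
    * by have /nA := MA _ _ Mxy; rewrite xE.
    * by have /nA := MA _ _ Mxy.
  + case=> [/nM//|[_ ->]//|[_ xE]|[dx _ _ _]]; first by have /nA := Ax; rewrite xE.
    by have /nA := Ax.
  + case=> [/MA/nA|[[/nA]]|[[By' nM']]|[dx _ Nx _]].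
    * by rewrite xE.
    * by rewrite xE.
    * rewrite xE => -[_ _ /double_inj]; by apply: eBinj; exact/mem_set.
    * by case: Nx; exists y; rewrite // xE.
  + case=> [/MA/nA//|[[/nA//]]|[uy' xE]|[_ y1' _ y2']].
    * by case: Nx; exists y'; rewrite // xE.
    * by rewrite [y]surjective_pairing [y']surjective_pairing y1 y2 y1' y2'.
- move=> x x' y [Mxy|[[Ax nM] yE]|[[By nM] ->]|[dx y1 Nx y2]].
  + case=> [Mx'y|[_ yE]|[[_ nM]]|[dx' y1 _ _]].
    * exact: Minj Mxy Mx'y.
    * by have /nB := MB _ _ Mxy; rewrite yE.
    * by have := nM _ Mxy.
    * by have /nB := MB _ _ Mxy; rewrite y1.
  + case=> [/MB/nB|[[Ax' nM']]|[[/nB]]|[dx' y1 Nx' y2]].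
    * by rewrite yE.
    * rewrite yE => -[_ _ /double_inj]; by apply: eAinj; exact/mem_set.
    * by rewrite yE.
    * have [hf _ _] := hbij x'.1.1; have := hf _ Nx'; rewrite -y2 yE/=.
      by case; exists x; rewrite // -y1 yE.
  + case=> [/nM//|[_ yE]|[_ ->]//|[dx' y1 _ _]]; first by have /nB := By; rewrite yE.
    by have /nB := By; rewrite y1.
  + case=> [/MB/nB|[ux' yE]|[[/nB]]|[dx' y1' Nx' y2']].
    * by rewrite y1.
    * have [hf _ _] := hbij x.1.1; have := hf _ Nx; rewrite -y2 yE/=.
      by case; exists x'; rewrite // -y1 yE.
    * by rewrite y1.
    * have x1 : x.1 = x'.1 by rewrite -y1 -y1'.
      rewrite [x]surjective_pairing [x']surjective_pairing x1; congr pair.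
      have [_ hi _] := hbij x'.1.1; apply: hi; rewrite ?inE//.
        by rewrite -x1.
      by rewrite -y2' y2 x1.
exists phi => // x /Gphi[Mx|[[Ax nM] ->]|[[By nM] xE]|[dx y1 _ _]].
- by constructor 1.
- by constructor 2.
- by constructor 3; split=> //; rewrite {1}xE.
- by constructor 4; split=> //; rewrite /diag_copies/= y1.
Qed.

(** * Limits along an ultrafilter *)

Section Ultrafilter.
Context (I : Type) (U : set_system I) (UU : UltraFilter U).

Lemma filter_exI (P Q : set I) : U P -> U Q -> exists i, P i /\ Q i.
Proof.
by move=> UP UQ; have /filter_ex : U (P `&` Q) by exact: filterI.
Qed.

Lemma ultra_finite (T : Type) (S : set T) (f : I -> T) : finite_set S ->
  U [set i | S (f i)] -> exists2 y, S y & U [set i | f i = y].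
Proof.
(* The bare type T receives a classical choice structure, so that S can be listed by a sequence. *)
elim/Pchoice: T => T in S f *; move=> /finite_seqP[s ->].
elim: s => [|y s IH] Us.
  by have /filter_ex[] := Us.
have [Uy|Uny] := in_ultra_setVsetC [set i | f i = y] UU.
  by exists y => //=; rewrite mem_head.
have [|y' y's Uy'] := IH; last by exists y' => //=; rewrite inE y's orbT.
apply: filterS2 Us Uny => i /=; rewrite inE => /orP[/eqP//|//].
Qed.

(** By compactness of [-C, C] the image filter has a cluster point, and a cluster point of an
    ultrafilter is a limit. *)
Lemma ultra_cvg (R : realType) (f : I -> R) (C : R) :
  U [set i | `|f i| <= C] -> exists l : R, f i @[i --> U] --> l.
Proof.
move=> UC; have : U [set i | `[- C, C]%classic (f i)].
  by apply: filterS UC => i /=; rewrite in_itv/= ler_norml.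
move=> fC; have [l [_ cl]] := @segment_compact R (- C) C (f @ U) _ fC; exists l => N Nl.
have [//|UN] := in_ultra_setVsetC (f @^-1` N) UU.
by have [y [nNy Ny]] := cl (~` N) N UN Nl.
Qed.

Lemma filter_all_in (T : eqType) (s : seq T) (P : T -> I -> Prop) :
  (forall x, x \in s -> U (P x)) -> U [set i | forall x, x \in s -> P x i].
Proof.
elim: s => [|y s IH] h; first exact: filterS filterT.
have Uy := h y (mem_head _ _).
have /IH Us x : x \in s -> U (P x) by move=> xs; apply: h; rewrite inE xs orbT.
by apply: filterS2 Uy Us => i Pi Ps x; rewrite inE => /orP[/eqP ->//|/Ps].
Qed.

Lemma cvg_sum_seq (R : realType) (T : eqType) (s : seq T) (f : T -> I -> R) (l : T -> R) :
  (forall x, x \in s -> f x i @[i --> U] --> l x) ->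
  (\sum_(x <- s) f x i) @[i --> U] --> \sum_(x <- s) l x.
Proof.
elim: s => [|y s IH] h.
  by rewrite big_nil; under eq_cvg do rewrite big_nil; exact: cvg_cst.
rewrite big_cons; under eq_cvg do rewrite big_cons.
apply: cvgD; first by apply: h; exact: mem_head.
by apply: IH => x xs; apply: h; rewrite inE xs orbT.
Qed.

Lemma cvg_le_near (R : realType) (f : I -> R) (l c : R) :
  f i @[i --> U] --> l -> U [set i | f i <= c] -> l <= c.
Proof.
move=> fl fc; rewrite leNgt; apply/negP => cl.
have gt : U [set i | c < f i] by exact: (cvgr_gt _ fl).
by have [i [/= /le_lt_trans h /h]] := filter_exI fc gt; rewrite ltxx.
Qed.

Lemma cvg_unique_near (R : realType) (f : I -> R) (l c : R) :
  f i @[i --> U] --> l -> U [set i | f i = c] -> l = c.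
Proof.
move=> fl fc; apply/eqP; rewrite eq_le; apply/andP; split.
  by apply: cvg_le_near fl _; apply: filterS fc => i /= ->.
rewrite -lerN2; apply: (@cvg_le_near _ (fun i => - f i)); first exact: (cvgN fl).
by apply: filterS fc => i /= ->.
Qed.

End Ultrafilter.

(** * Persistence of the points of a diagram *)

Section Points.
Context (R : realType).
Implicit Types (A B : diagram R) (x y : ipoint R).

Lemma offdiag_pers_gt0 A x : offdiag A x -> 0 < pers x.1.
Proof. by move=> /offdiag_above; rewrite /above_diag /pers/= subr_gt0. Qed.

Lemma diag_pers x : diag_copies x -> pers x.1 = 0.
Proof. by rewrite /diag_copies /pers/= => ->; rewrite subrr. Qed.

Lemma points_pers_ge0 A x : points A x -> 0 <= pers x.1.
Proof. by case=> [/offdiag_pers_gt0/ltW//|/diag_pers ->]. Qed.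

Lemma points_offdiag A x : points A x -> 0 < pers x.1 -> offdiag A x.
Proof. by case=> // /diag_pers ->; rewrite ltxx. Qed.

Lemma points_diag A x : points A x -> ~ offdiag A x -> diag_copies x.
Proof. by case. Qed.

End Points.

(** * Limits of points and of bijections along an ultrafilter *)

Definition cvgp (R : realType) (I : Type) (U : set_system I) (f : I -> ipoint R) (l : R * R) :=
  (f i).1.1 @[i --> U] --> l.1 /\ (f i).1.2 @[i --> U] --> l.2.

Section Limit.
Context (R : realType) (p : R) (q : \bar R) (adm : admissible p q).
Context (I : Type) (U : set_system I) (UU : UltraFilter U).
Implicit Types (A B : diagram R) (x y : ipoint R).

Let p0 : 0 < p := admissible_gt0 adm.

Lemma cvgp_near_eq (f g : I -> ipoint R) l :
  U [set i | f i = g i] -> cvgp U f l -> cvgp U g l.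
Proof.
move=> fg [f1 f2]; split.
  by apply: cvg_trans f1; apply: near_eq_cvg; apply: filterS fg => i /= ->.
by apply: cvg_trans f2; apply: near_eq_cvg; apply: filterS fg => i /= ->.
Qed.

Lemma cvgp_cst x : cvgp U (fun=> x) x.1.
Proof. by split; exact: cvg_cst. Qed.

Lemma cvgp_eq (f : I -> ipoint R) l y : cvgp U f l -> U [set i | f i = y] -> y.1 = l.
Proof.
move=> [f1 f2] fy; rewrite [RHS]surjective_pairing.
rewrite (cvg_unique_near UU f1 (c := y.1.1)); last by apply: filterS fy => i /= ->.
rewrite (cvg_unique_near UU f2 (c := y.1.2)); last by apply: filterS fy => i /= ->.
by rewrite -surjective_pairing.
Qed.

Lemma cvgp_pers (f : I -> ipoint R) l : cvgp U f l ->
  pers (f i).1 @[i --> U] --> pers l.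
Proof. by case=> f1 f2; exact: cvgB. Qed.

(** Almost always the persistence exceeds half its limit, which leaves finitely many candidates in
    B. The ultrafilter selects one of them, index included, although convergence sees geometric
    components only. *)
Lemma offdiag_limit B (f : I -> ipoint R) l : locally_finite B ->
  U [set i | points B (f i)] -> cvgp U f l -> 0 < pers l ->
  exists2 y, offdiag B y & U [set i | f i = y].
Proof.
move=> lfB Bf fl l0.
have e0 : 0 < pers l / 2 by rewrite divr_gt0.
have gt : U [set i | pers l / 2 < pers (f i).1].
  apply: (cvgr_gt _ (cvgp_pers fl)); by rewrite ltr_pdivrMr// ltr_pMr// ltr1n.
have [|y [By _] Uy] := ultra_finite UU (f := f) (lfB _ e0); last by exists y.
  apply: filterS2 Bf gt => i /= Bi gti; split; last exact: ltW.
  by apply: points_offdiag Bi _; exact: lt_trans gti.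
Qed.

(** The limit has nonnegative persistence, and by [offdiag_limit] positive persistence would make
    some off-diagonal point of B the value for almost all i. *)
Lemma unmatched_limit B (f : I -> ipoint R) l : locally_finite B ->
  (forall i, points B (f i)) -> cvgp U f l ->
  (forall y, offdiag B y -> ~ U [set i | f i = y]) -> l = (l.1, l.1).
Proof.
move=> lfB Bf fl nB; rewrite {1}[l]surjective_pairing; congr pair.
have := cvgp_pers fl => flp.
have l0 : 0 <= pers l.
  rewrite -oppr_le0; apply: (cvg_le_near UU (f := fun i => - pers (f i).1)).
    exact: (cvgN flp).
  by apply: filterE => i /=; rewrite oppr_le0; exact: points_pers_ge0 (Bf i).
apply/eqP; rewrite -subr_eq0 eq_le; apply/andP; split => //.
rewrite leNgt; apply/negP => l1.
have [|y By] := offdiag_limit lfB _ fl l1; first exact: filterE.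
exact: nB.
Qed.

Lemma bounded_cvgp (f : I -> ipoint R) x K :
  (forall i, gauge p q (x.1 - (f i).1) <= K) -> exists l, cvgp U f l.
Proof.
move=> fK.
have bd (c : I -> R) (a : R) : (forall i, `|a - c i| `^ p <= K) ->
    exists l : R, c i @[i --> U] --> l.
  move=> h; apply: (@ultra_cvg _ _ UU _ c (`|a| + K `^ p^-1)).
  apply: filterE => i /=.
  have K0 : 0 <= K by apply: le_trans (h i); exact: powR_ge0.
  have : `|a - c i| <= K `^ p^-1.
    rewrite leNgt; apply/negP => /(gt0_ltr_powR p0).
    rewrite !nnegrE powR_ge0 normr_ge0 => /(_ isT isT).
    by rewrite -powRrM mulVf ?gt_eqF// powRr1// ltNge h.
  move=> le; have -> : c i = a - (a - c i) by rewrite opprB addrCA subrr addr0.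
  by rewrite (le_trans (ler_normB _ _))// lerD2l.
have [l1 h1] : exists l : R, (f i).1.1 @[i --> U] --> l.
  by apply: (bd _ x.1.1) => i; apply: le_trans (fK i); have [] := gauge_coord adm (x.1 - (f i).1).
have [l2 h2] : exists l : R, (f i).1.2 @[i --> U] --> l.
  by apply: (bd _ x.1.2) => i; apply: le_trans (fK i); have [] := gauge_coord adm (x.1 - (f i).1).
by exists (l1, l2).
Qed.

Lemma total_cost_le1 A (phi : ipoint R -> ipoint R) x K :
  total_cost_le p q A phi K -> points A x -> gauge p q (x.1 - (phi x).1) <= K.
Proof.
move=> le Ax; have := le [:: x]; rewrite big_seq1; apply=> // y.
by rewrite inE => /eqP ->.
Qed.

(** The remaining points are diagonal copies sent to diagonal copies. A limit matching keeps their
    geometric component, so they cost nothing and need no approximation. *)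
Definition active A B (phi0 : ipoint R -> ipoint R) x :=
  offdiag A x \/ offdiag B (phi0 x).

(* [tr i x] is the point of A whose image under [phi i] approximates the pair
   (x, phi0 x): it is x itself for x off the diagonal, and the preimage of
   [phi0 x] under [phi i] when [phi0 x] is off the diagonal. *)
Definition limit_matching A B (phi : I -> ipoint R -> ipoint R)
    (phi0 : ipoint R -> ipoint R) (tr : I -> ipoint R -> ipoint R) :=
  [/\ forall x, points A x -> active A B phi0 x ->
        [/\ forall i, points A (tr i x), cvgp U (fun i => tr i x) x.1
          & cvgp U (fun i => phi i (tr i x)) (phi0 x).1],
      forall x x', points A x -> points A x' ->
        active A B phi0 x -> active A B phi0 x' ->
        U [set i | tr i x = tr i x'] -> x = x',
      forall x, offdiag A x -> forall i, tr i x = x,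
      forall x, points A x -> offdiag B (phi0 x) ->
        U [set i | phi i (tr i x) = phi0 x]
    & forall x, points A x -> ~ active A B phi0 x -> (phi0 x).1 = x.1 ].

(** The bound K makes images and preimages of every point converge. Off-diagonal pairs matched by
    [phi i] for almost all i form [M]. An off-diagonal point outside [M] has images, or preimages,
    converging to the diagonal, and [extend_matching] pairs it with a copy of that limit. *)
Lemma exists_limit_matching A B (phi : I -> ipoint R -> ipoint R) K :
  locally_finite A -> locally_finite B ->
  (forall i, set_bij (points A) (points B) (phi i)) ->
  (forall i, total_cost_le p q A (phi i) K) ->
  exists phi0 tr, set_bij (points A) (points B) phi0 /\
    limit_matching A B phi phi0 tr.
Proof.
move=> lfA lfB bij le.
have phiB i x : points A x -> points B (phi i x) by have [h _ _] := bij i => /h.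
have phiI i x x' : points A x -> points A x' -> phi i x = phi i x' -> x = x'.
  by have [_ h _] := bij i => Ax Ax'; apply: h; exact/mem_set.
have /choice[psi hpsi] : forall i, exists psi : ipoint R -> ipoint R,
    forall y, points B y -> points A (psi y) /\ phi i (psi y) = y.
  move=> i.
  have /choice[g hg] : forall y, exists x, points B y -> points A x /\ phi i x = y;
    last by exists g.
  move=> y.
  have [By|nBy] := pselect (points B y); last by exists y.
  by have [_ _ /(_ y By)[x Ax xy]] := bij i; exists x.
have /choice[a ha] : forall x, exists l, points A x -> cvgp U (fun i => phi i x) l.
  move=> x; have [Ax|nAx] := pselect (points A x); last by exists 0.
  have [|l hl] := @bounded_cvgp (fun i => phi i x) x K; last by exists l.
  by move=> i; exact: total_cost_le1.
have /choice[b hb] : forall y, exists l, points B y -> cvgp U (fun i => psi i y) l.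
  move=> y; have [By|nBy] := pselect (points B y); last by exists 0.
  have [|l hl] := @bounded_cvgp (fun i => psi i y) y K; last by exists l.
  move=> i; have [Ax xy] := hpsi i y By.
  by rewrite -gaugeN opprB -{2}xy; exact: total_cost_le1.
pose M x y := [/\ offdiag A x, offdiag B y & U [set i | phi i x = y]].
have [|||phi0 bij0 h0] := @extend_matching R A B M (fun x => (a x).1) (fun y => (b y).1).
- by move=> x y [].
- move=> x y y' [_ _ h] [_ _ h'].
  by have [i [/= <- <-]] := filter_exI UU h h'.
- move=> x x' y [Ax _ h] [Ax' _ h'].
  have [i [/= e e']] := filter_exI UU h h'.
  by apply: (phiI i); [left | left | rewrite e].
have nA x : offdiag A x -> diag_copies x -> False.
  by move=> /offdiag_pers_gt0 + /diag_pers e; rewrite e ltxx.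
have nB y : offdiag B y -> diag_copies y -> False.
  by move=> /offdiag_pers_gt0 + /diag_pers e; rewrite e ltxx.
exists phi0, (fun i x => if pselect (offdiag A x) then x else psi i (phi0 x)).
split=> //; split.
- move=> x Ax act; have Bx : points B (phi0 x) by have [h _ _] := bij0; exact: h.
  case: pselect => [ox|nox].
    split; [by [] | exact: cvgp_cst |].
    case: (h0 x Ax) => [[_ _ h]|[_ nM ->]|[_ _ xE]|[dx]].
    + apply: (@cvgp_near_eq (fun=> phi0 x)); last exact: cvgp_cst.
      by apply: filterS h => i /= ->.
    + rewrite -(unmatched_limit lfB _ (ha x Ax)); first exact: ha.
        by move=> i; exact: phiB.
      by move=> y By Uy; apply: (nM y).
    + by case: (nA x ox); rewrite /diag_copies/= xE.
    + by case: (nA x ox).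
  have By : offdiag B (phi0 x) by case: act.
  split; [by move=> i; have [] := hpsi i _ Bx | | ].
    case: (h0 x Ax) => [[/nox//]|[/nox//]|[_ nM xE]|[_ dy]]; last by case: (nB _ By).
    rewrite xE -(unmatched_limit lfA _ (hb _ Bx)); first exact: hb.
      by move=> i; have [] := hpsi i _ Bx.
    move=> x' Ax' Ux'; apply: (nM x'); split=> //.
    by apply: filterS Ux' => i /= <-; have [_ ->] := hpsi i _ Bx.
  apply: (@cvgp_near_eq (fun=> phi0 x)); last exact: cvgp_cst.
  by apply: filterE => i /=; have [_ ->] := hpsi i _ Bx.
(* If these two tracks agreed almost always, x and [phi0 x'] would form a pair of [M], whereas
   [phi0 x'] is left unmatched by [M]. *)
- have mixed x x' : points A x -> offdiag A x -> points A x' -> ~ offdiag A x' ->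
    offdiag B (phi0 x') -> ~ U [set i | x = psi i (phi0 x')].
    move=> Ax ox Ax' nox' oy' Ux.
    have : M x (phi0 x').
      split=> //; apply: filterS Ux => i /= ->.
      by have [|_ ->] := hpsi i (phi0 x'); first by left.
    case: (h0 x' Ax') => [[/nox'//]|[/nox'//]|[_ nM _]|[_ dy]]; first exact: nM.
    by case: (nB _ oy').
  move=> x x' Ax Ax' act act'.
  case: pselect => [ox|nox]; case: pselect => [ox'|nox'].
  + by move=> /filter_ex[].
  + by case: act' => // oy' /(mixed _ _ Ax ox Ax' nox' oy').
  + case: act => // oy h; case: (mixed _ _ Ax' ox' Ax nox oy).
    by apply: filterS h => i /= ->.
  + case: act => // oy; case: act' => // oy' /filter_ex[i /= e].
    have [_ h _] := bij0; apply: h; [exact/mem_set | exact/mem_set |].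
    have [|_ <-] := hpsi i (phi0 x); first by left.
    by have [|_ <-] := hpsi i (phi0 x'); [left | rewrite e].
- by move=> x ox i; case: pselect.
- move=> x Ax oy; case: pselect => [ox|nox].
    case: (h0 x Ax) => [[]//|[_ _ yE]|[_ _ xE]|[dx]].
    + by case: (nB _ oy); rewrite /diag_copies/= yE.
    + by case: (nA x ox); rewrite /diag_copies/= xE.
    + by case: (nA x ox).
  by apply: filterE => i /=; have [|_ ->] := hpsi i (phi0 x); first by left.
- move=> x Ax nact; case: (h0 x Ax) => [[ox]|[ox]|[oy]|[_ _ ->//]].
  + by case: nact; left.
  + by case: nact; left.
  + by case: nact; right.
Qed.

(** Lower semicontinuity of the cost. In a finite sum for [phi0] the idle points contribute 0 and
    the active terms are limits of terms at the tracked points. These are distinct for almost all i,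
    so their terms form a partial sum of the cost of [phi i]. *)
Lemma limit_matching_cost A B phi phi0 tr C :
  limit_matching A B phi phi0 tr ->
  U [set i | total_cost_le p q A (phi i) C] -> total_cost_le p q A phi0 C.
Proof.
move=> [trcvg inj _ _ idle] UC s us sA.
pose act x := `[< active A B phi0 x >].
rewrite (bigID act)/= [X in _ + X]big_seq_cond [X in _ + X]big1; last first.
  move=> x /andP[xs /asboolP nact].
  by rewrite idle ?subrr ?gauge0//; exact: sA.
rewrite addr0 -big_filter; set s' := [seq x <- s | act x].
have s'A x : x \in s' -> points A x /\ active A B phi0 x.
  by rewrite mem_filter => /andP[/asboolP ? /sA].
apply: (@cvg_le_near _ _ UU _
    (fun i => \sum_(x <- s') gauge p q ((tr i x).1 - (phi i (tr i x)).1))).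
  apply: (cvg_sum_seq UU (f := fun x i => gauge p q ((tr i x).1 - (phi i (tr i x)).1))).
  move=> x /s'A[Ax actx]; have [_ [t1 t2] [u1 u2]]   := trcvg x Ax actx.
  by apply: gauge_cvg => //; exact: cvgB.
have : U [set i | forall x, x \in s' -> forall x', x' \in s' -> tr i x = tr i x' -> x = x'].
  apply: (filter_all_in UU) => x xs'; apply: (filter_all_in UU) => x' x's'.
  have [Ax ax] := s'A x xs'; have [Ax' ax'] := s'A x' x's'.
  have [e|] := in_ultra_setVsetC [set i | tr i x = tr i x'] UU.
    by rewrite (inj _ _ Ax Ax' ax ax' e); exact: filterE.
  by apply: filterS => i /= ne /ne.
move=> Uinj; apply: filterS2 UC Uinj => i /= le inji.
rewrite -(big_map (tr i) xpredT (fun x => gauge p q (x.1 - (phi i x).1))).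
apply: le.
  by rewrite map_inj_in_uniq ?filter_uniq// => x x' xs x's; exact: inji.
move=> _ /mapP[x /s'A[Ax ax] ->].
by have [h _ _]   := trcvg x Ax ax.
Qed.

End Limit.

(** * Optimal bijections and their concatenation *)

Section Optimal.
Context (R : realType) (p : R) (q : \bar R) (adm : admissible p q).
Implicit Types (A B : diagram R).

Let p0 : 0 < p := admissible_gt0 adm.

(** Bijections of cost at most c + 1/(n+1) have a limit along an ultrafilter containing all tails of
    the naturals, and semicontinuity bounds its cost by c. The coarse bound (c + 1)^p makes the
    limits of points exist. *)
Lemma exists_optimal A B (c : R) :
  locally_finite A -> locally_finite B -> dist p q A B = c%:E ->
  exists2 phi, set_bij (points A) (points B) phi &
    total_cost_le p q A phi (c `^ p).
Proof.
move=> lfA lfB dc; have c0 : 0 <= c by rewrite -lee_fin -dc dist_ge0.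
pose K (n : nat) := (c + n.+1%:R^-1) `^ p.
have /choice[phi hphi] : forall n : nat, exists phi : ipoint R -> ipoint R,
    set_bij (points A) (points B) phi /\ total_cost_le p q A phi (K n).
  move=> n; have [|phi bij le] := @dist_lt R p q A B (c + n.+1%:R^-1) p0; last by exists phi.
  by rewrite dc lte_fin ltrDl.
have mono (x y : R) : 0 <= x -> x <= y -> x `^ p <= y `^ p.
  by move=> x0 xy; apply: (ge0_ler_powR (ltW p0)); rewrite ?nnegrE// (le_trans x0).
have [U [UU ooU]] := ultraFilterLemma eventually_filter.
have [||phi0 [tr [bij0 lim]]] :=
  exists_limit_matching adm UU lfA lfB (phi := phi) (K := (c + 1) `^ p).
- by move=> n; have [] := hphi n.
- move=> n; have [_] := hphi n; apply: total_cost_le_total; apply: mono.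
    by rewrite addr_ge0.
  by rewrite lerD2l invf_le1// ler1n.
exists phi0 => // s us sA; apply/ler_addgt0Pl => e e0; rewrite addrC.
suff : total_cost_le p q A phi0 (c `^ p + e) by exact.
apply: (limit_matching_cost adm UU lim).
have Kc : K n @[n --> \oo] --> c `^ p.
  apply: cvg_powR => //; first by move=> n; rewrite addr_ge0.
  rewrite -[X in _ --> X]addr0; apply: cvgD; [exact: cvg_cst | exact: cvg_harmonic].
apply: ooU; have : \forall n \near \oo, K n <= c `^ p + e.
  by apply: (cvgr_le _ Kc); rewrite ltrDl.
apply: filterS => n /= Kn; have [_] := hphi n; exact: total_cost_le_total.
Qed.

(** The gap at [x0] lowers the bound even for lists that omit [x0], since the bound on g may be
    applied after adding [x0] to the list. *)
Lemma sum_le_strict (T : eqType) (S : set T) (f g : T -> R) (K : R) x0 :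
  (forall x, 0 <= f x <= g x) -> S x0 ->
  (forall s : seq T, uniq s -> (forall x, x \in s -> S x) -> \sum_(x <- s) g x <= K) ->
  forall s : seq T, uniq s -> (forall x, x \in s -> S x) ->
    \sum_(x <- s) f x <= K - (g x0 - f x0).
Proof.
move=> fg Sx0 gK s us sS.
pose s' := [seq x <- s | x != x0].
have le : \sum_(x <- s) f x <= f x0 + \sum_(x <- s') f x.
  have f0 x : 0 <= f x by have /andP[] := fg x.
  have [xs|xs] := boolP (x0 \in s).
    by rewrite (bigD1_seq x0)//= -big_filter.
  rewrite /s' (all_filterP _) ?lerDr//.
  by apply/allP => x xs'; apply: contra xs => /eqP <-.
have := gK (x0 :: s'); rewrite big_cons /= mem_filter eqxx filter_uniq// => /(_ isT) leK.
have : g x0 + \sum_(x <- s') g x <= K.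
  by apply: leK => x; rewrite inE mem_filter => /predU1P[->//|/andP[_ /sS]].
have : \sum_(x <- s') f x <= \sum_(x <- s') g x.
  by apply: ler_sum => x _; have /andP[] := fg x.
lra.
Qed.

(* Equality in the convexity inequality [gauge_add] forces the two
   displacements to be proportional. *)
Lemma concat_optimal A B C (a b d : R) (f g : ipoint R -> ipoint R) :
  0 < a -> 0 < b -> 0 <= d -> dist p q A C = ((a + b) * d)%:E ->
  set_bij (points A) (points B) f -> set_bij (points B) (points C) g ->
  total_cost_le p q A f ((a * d) `^ p) -> total_cost_le p q B g ((b * d) `^ p) ->
  total_cost_le p q A (g \o f) (((a + b) * d) `^ p) /\
  forall x, points A x ->
    b * (x.1 - (f x).1).1 = a * ((f x).1 - (g (f x)).1).1 /\
    b * (x.1 - (f x).1).2 = a * ((f x).1 - (g (f x)).1).2.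
Proof.
move=> a0 b0 d0 dAC bf bg lef leg.
have ab0 : 0 < a + b by rewrite addr_gt0.
have bgf : set_bij (points A) (points C) (g \o f) by exact: set_bij_comp bf bg.
pose u x := x.1 - (f x).1; pose v x := (f x).1 - (g (f x)).1.
have uv x : x.1 - (g (f x)).1 = u x + v x by rewrite /u /v addrA subrK.
(* By convexity [F] is at most [G] pointwise. Finite sums of [G] are at most d^p, because f and g
   cost at most d times their durations a and b. *)
pose F x := gauge p q (u x + v x) / (a + b) `^ p.
pose G x := a / (a + b) * (gauge p q (u x) / a `^ p) + b / (a + b) * (gauge p q (v x) / b `^ p).
have FG x : 0 <= F x <= G x.
  by rewrite divr_ge0 ?gauge_ge0 ?powR_ge0//=; have [] := gauge_add adm (u x) (v x) a0 b0.
have GK (s : seq (ipoint R)) : uniq s -> (forall x, x \in s -> points A x) ->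
    \sum_(x <- s) G x <= d `^ p.
  move=> us sA; rewrite big_split/= -!mulr_sumr -!mulr_suml.
  have lea : (\sum_(x <- s) gauge p q (u x)) / a `^ p <= d `^ p.
    by rewrite ler_pdivrMr ?powR_gt0// mulrC -powRM ?(ltW a0)//; exact: lef.
  have leb : (\sum_(x <- s) gauge p q (v x)) / b `^ p <= d `^ p.
    rewrite ler_pdivrMr ?powR_gt0// mulrC -powRM ?(ltW b0)//.
    rewrite -(big_map f xpredT (fun y => gauge p q (y.1 - (g y).1))); apply: leg.
      have [_ fi _] := bf; rewrite map_inj_in_uniq// => x y xs ys.
      by apply: fi; apply/mem_set; exact: sA.
    by move=> _ /mapP[x /sA Ax ->]; have [h _ _] := bf; exact: h.
  have ka : 0 <= a / (a + b) by rewrite divr_ge0 ?ltW.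
  have kb : 0 <= b / (a + b) by rewrite divr_ge0 ?ltW.
  apply: le_trans (lerD (ler_wpM2l ka lea) (ler_wpM2l kb leb)) _.
  by rewrite -!mulrDl divff ?gt_eqF// mul1r.
have costE c : (forall s : seq (ipoint R), uniq s -> (forall x, x \in s -> points A x) ->
    \sum_(x <- s) F x <= c) -> total_cost_le p q A (g \o f) ((a + b) `^ p * c).
  move=> h s us sA; under eq_bigr do rewrite /= uv.
  by rewrite mulrC -ler_pdivrMr ?powR_gt0// mulr_suml; exact: h.
split.
  rewrite powRM ?(ltW ab0)//; apply: costE => s us sA.
  apply: le_trans (GK s us sA); apply: ler_sum => x _; by have /andP[] := FG x.
move=> x0 Ax0.
suff FG0 : G x0 <= F x0.
  have leif := gauge_add adm (u x0) (v x0) a0 b0.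
  have := leif.2; rewrite eq_le [X in X && _]leif.1 [X in _ && X]FG0/=.
  by move=> /esym/andP[/eqP -> /eqP ->].
(* A strict gap at [x0] would bound all finite sums of [F] by d^p - e, and the composite would cost
   less than (a + b) d, the distance from A to C. *)
rewrite leNgt; apply/negP => lt.
set e := G x0 - F x0; have e0 : 0 < e by rewrite subr_gt0.
have Fe := sum_le_strict FG Ax0 GK; rewrite -/e in Fe.
have de : 0 <= d `^ p - e by have := Fe [::]; rewrite big_nil; apply.
have := costE _ Fe.
have pV : (d `^ p - e) = ((d `^ p - e) `^ p^-1) `^ p.
  by rewrite -powRrM mulVf ?gt_eqF// powRr1.
rewrite pV -powRM ?powR_ge0 ?(ltW ab0)// => le.
have := dist_le p0 _ bgf le; rewrite mulr_ge0 ?powR_ge0 ?(ltW ab0)// => /(_ isT).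
rewrite dAC lee_fin ler_pM2l//; apply/negP; rewrite -ltNge.
have dE : d = (d `^ p) `^ p^-1 by rewrite -powRrM mulfV ?gt_eqF// powRr1.
rewrite [ltRHS]dE.
by apply: gt0_ltr_powR; rewrite ?nnegrE ?invr_gt0 ?powR_ge0// ltrBlDr ltrDl.
Qed.

(** Induction on the times: an optimal bijection from [mu s] to the next diagram is put before the
    composite for the later times. By [concat_optimal] the composite is again optimal and each point
    keeps its velocity. The convex combinations are written with the denominator 1 - s cleared. *)
Lemma geodesic_finite_times (mu : R -> diagram R) (d : R) : 0 <= d ->
  (forall t, 0 <= t <= 1 -> locally_finite (mu t)) ->
  (forall s t, 0 <= s <= 1 -> 0 <= t <= 1 -> dist p q (mu s) (mu t) = (`|t - s| * d)%:E) ->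
  forall (T : seq R) (s : R), path <%R s T -> 0 <= s -> all (< 1) (s :: T) ->
  exists phi, [/\ set_bij (points (mu s)) (points (mu 1)) phi,
    total_cost_le p q (mu s) phi (((1 - s) * d) `^ p) &
    forall t, t \in T -> exists2 psi, set_bij (points (mu s)) (points (mu t)) psi &
      forall x, points (mu s) x ->
        (1 - s) * (psi x).1.1 = (1 - t) * x.1.1 + (t - s) * (phi x).1.1 /\
        (1 - s) * (psi x).1.2 = (1 - t) * x.1.2 + (t - s) * (phi x).1.2 ].
Proof.
move=> d0 lf dmu; elim=> [|t0 T IH] s /=.
  rewrite andbT => _ s0 s1.
  have s01 : 0 <= s <= 1 by rewrite s0 ltW.
  have [|||phi bij le] := @exists_optimal (mu s) (mu 1) ((1 - s) * d).
  - exact: lf.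
  - by apply: lf; rewrite ler01 lexx.
  - by rewrite dmu ?ler01 ?lexx// ger0_norm// subr_ge0 ltW.
  by exists phi; split.
move=> /andP[st pT] s0 /and3P[s1 t1 allT].
have t0ge : 0 <= t0 by rewrite (le_trans s0)// ltW.
have [|phi1 [bij1 le1 h1]] := IH t0 pT t0ge; first by rewrite /= t1.
have s01 : 0 <= s <= 1 by rewrite s0 ltW.
have t01 : 0 <= t0 <= 1 by rewrite t0ge ltW.
have [|||chi bijc lec] := @exists_optimal (mu s) (mu t0) ((t0 - s) * d).
- exact: lf.
- exact: lf.
- by rewrite dmu// ger0_norm// subr_ge0 ltW.
have a0 : 0 < t0 - s by rewrite subr_gt0.
have b0 : 0 < 1 - t0 by rewrite subr_gt0.
have abE : t0 - s + (1 - t0) = 1 - s by ring.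
have [|le hx] := concat_optimal a0 b0 d0 _ bijc bij1 lec le1.
  by rewrite dmu ?ler01 ?lexx// ger0_norm ?subr_ge0 1?ltW// abE.
rewrite abE in le; exists (phi1 \o chi); split => //; first exact: set_bij_comp bijc bij1.
have key (x c f : R) : (1 - t0) * (x - c) = (t0 - s) * (c - f) ->
    (1 - s) * c = (1 - t0) * x + (t0 - s) * f.
  by move=> h; apply/eqP; rewrite -subr_eq0 -[X in X == _]opprK oppr_eq0; apply/eqP;
   transitivity ((1 - t0) * (x - c) - (t0 - s) * (c - f)); [ring | rewrite h subrr].
move=> t; rewrite inE => /predU1P[->|tT].
  by exists chi => // x Ax; have [h1' h2'] := hx x Ax; split; exact: key.
have [psi bijp hp] := h1 t tT.
exists (psi \o chi); first exact: set_bij_comp bijc bijp.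
have key2 (x c f z : R) : (1 - t0) * (x - c) = (t0 - s) * (c - f) ->
    (1 - t0) * z = (1 - t) * c + (t - t0) * f ->
    (1 - s) * z = (1 - t) * x + (t - s) * f.
  move=> /key hc hz; apply: (mulfI (lt0r_neq0 b0)).
  rewrite mulrCA hz mulrDr mulrCA hc; ring.
move=> x Ax; have [e1 e2] := hx x Ax.
have [|z1 z2] := hp (chi x); first by have [h _ _] := bijc; exact: h.
by split; [exact: key2 e1 z1 | exact: key2 e2 z2].
Qed.

End Optimal.

(** * Multiplicities of convex combinations in the limit *)

Section LimitConvexComb.
Context (R : realType) (I : Type) (U : set_system I) (UU : UltraFilter U).

(** Over each z above the diagonal, x corresponds to the point w of Z that [psi i] assigns to the
    track of x for almost all i. Such a w exists because these images converge to z and Z is locally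
    finite. *)
Lemma limit_convex_comb (A B Z : diagram R) (phi psi : I -> ipoint R -> ipoint R)
    (phi0 : ipoint R -> ipoint R) (tr : I -> ipoint R -> ipoint R) (t : R) :
  locally_finite A -> locally_finite B -> locally_finite Z ->
  (forall i, set_bij (points A) (points B) (phi i)) ->
  set_bij (points A) (points B) phi0 ->
  limit_matching U A B phi phi0 tr -> 0 < t < 1 ->
  U [set i | set_bij (points A) (points Z) (psi i) /\
    forall x, points A x -> (psi i x).1 = convex_comb t x.1 (phi i x).1] ->
  is_convex_comb A phi0 t Z.
Proof.
move=> lfA lfB lfZ bij [phi0B phi0I phi0S] [trcvg trinj trA trB idle] /andP[t0 t1] good z zlt.
have z0 : 0 < pers z by rewrite /pers subr_gt0.
have goodI : U [set i | forall x x', points A x -> points A x' ->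
    psi i x = psi i x' -> x = x'].
  apply: filterS good => i [[_ h _] _] /= x x' Ax Ax'.
  by apply: h; exact/mem_set.
have track_cvg x : points A x -> active A B phi0 x ->
    cvgp U (fun i => psi i (tr i x)) (convex_comb t x.1 (phi0 x).1).
  move=> Ax ax; have [Atr [c1 c2] [d1 d2]] := trcvg x Ax ax.
  have e : U [set i | convex_comb t (tr i x).1 (phi i (tr i x)).1 = (psi i (tr i x)).1].
    by apply: filterS good => i [_ /= ->].
  split.
    apply: (@cvg_trans _ ((convex_comb t (tr i x).1 (phi i (tr i x)).1).1 @[i --> U])).
      by apply: near_eq_cvg; apply: filterS e => i ei; exact: (congr1 fst ei).
    by apply: cvgD; apply: cvgMr.
  apply: (@cvg_trans _ ((convex_comb t (tr i x).1 (phi i (tr i x)).1).2 @[i --> U])).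
    by apply: near_eq_cvg; apply: filterS e => i ei; exact: (congr1 snd ei).
  by apply: cvgD; apply: cvgMr.
pose G x w := [/\ points A x, active A B phi0 x & U [set i | psi i (tr i x) = w]].
pose S := [set x | points A x /\ convex_comb t x.1 (phi0 x).1 = z].
pose W := [set w | points Z w /\ w.1 = z].
have [||||f bijf _] := @set_bij_of_rel _ S W G; last by apply/card_esym/card_set_bijP; exists f.
- move=> x [Ax xz].
  have ax : active A B phi0 x.
    apply: contrapT => nax; have e := idle x Ax nax.
    have nA : ~ offdiag A x by move=> ox; apply: nax; left.
    have zx : z = x.1.
      rewrite -xz e /convex_comb -!mulrDl subrK !mul1r.
      by rewrite -surjective_pairing.
    by have := diag_pers (points_diag Ax nA); rewrite -zx => p0; rewrite p0 ltxx in z0.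
  have cz := track_cvg x Ax ax; rewrite xz in cz.
  have [|w ow Uw] := offdiag_limit UU lfZ _ cz z0.
    apply: filterS good => i [[h _ _] _] /=; apply: h.
    by have [h _ _] := trcvg x Ax ax; exact: h.
  by exists w; [split; [left | exact: cvgp_eq cz Uw] | split].
- move=> w [Zw wz].
  have [xi hxi] : exists xi : I -> ipoint R, U [set i | points A (xi i) /\ psi i (xi i) = w].
    have /choice[xi hxi] : forall i, exists x,
        set_bij (points A) (points Z) (psi i) -> points A x /\ psi i x = w.
      move=> i.
      have [[_ _ /(_ w Zw)[x Ax xw]]|nb] := pselect (set_bij (points A) (points Z) (psi i)).
        by exists x.
      by exists w.
    by exists xi; apply: filterS good => i [/hxi].
  suff [x [Ax ax xix]] : exists x, [/\ points A x, active A B phi0 x & U [set i | tr i x = xi i]].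
    have Uw : U [set i | psi i (tr i x) = w].
      by apply: filterS2 hxi xix => i /= [_ <-] ->.
    exists x; last by split.
    split => //; rewrite -wz; symmetry; exact: cvgp_eq (track_cvg x Ax ax) Uw.
  (* Persistence is affine, so one end of the segment through z has persistence at least that of z
     for almost all i. Local finiteness of A or B then fixes that end, and [xi] is the track of a
     single active point. *)
  have Uz : U [set i | pers z = (1 - t) * pers (xi i).1 + t * pers (phi i (xi i)).1].
    apply: filterS2 good hxi => i /= [_ h] [Ai iw].
    by rewrite -wz -iw h//= /pers/=; ring.
  have [le|nle] := in_ultra_setVsetC [set i | pers z <= pers (xi i).1] UU.
    have [|x [ox _] Ux] := ultra_finite UU (f := xi) (lfA _ z0).
      apply: filterS2 le hxi => i /= zi [Ai _]; split => //.
      by apply: points_offdiag Ai _; exact: lt_le_trans zi.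
    exists x; split; [by left | by left |].
    by apply: filterS Ux => i /= ->; exact: trA.
  have le : U [set i | pers z <= pers (phi i (xi i)).1].
    apply: filterS2 Uz nle => i /= zE /negP; rewrite -ltNge => lt.
    rewrite leNgt; apply/negP => lt'.
    have : (1 - t) * pers (xi i).1 < (1 - t) * pers z by rewrite ltr_pM2l// subr_gt0.
    have : t * pers (phi i (xi i)).1 < t * pers z by rewrite ltr_pM2l.
    by rewrite mulrBl mul1r; lra.
  have [|y [oy _] Uy] := ultra_finite UU (f := fun i => phi i (xi i)) (lfB _ z0).
    apply: filterS2 le hxi => i /= zi [Ai _]; split => //.
    apply: points_offdiag (lt_le_trans z0 zi); have [h _ _] := bij i; exact: h.
  have [x Ax xy] : exists2 x, points A x & phi0 x = y by apply: phi0S; left.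
  have ax : active A B phi0 x by right; rewrite xy.
  exists x; split => //; have := trB x Ax; rewrite xy => /(_ oy) Uxy.
  apply: filterS3 Uxy Uy hxi => i /= e1 e2 [Ai _].
  have [_ h _] := bij i; apply: h; [apply/mem_set | exact/mem_set | by rewrite e1 e2].
  by have [h _ _] := trcvg x Ax ax; exact: h.
- move=> x w w' [_ _ h] [_ _ h'].
  by have [i [/= <- <-]] := filter_exI UU h h'.
- move=> x x' w [Ax ax h] [Ax' ax' h']; apply: trinj => //.
  apply: filterS3 goodI h h' => i /= inj e e'.
  apply: inj; [| | by rewrite e e'].
    by have [? _ _] := trcvg x Ax ax.
  by have [? _ _] := trcvg x' Ax' ax'.
Qed.

End LimitConvexComb.

(** * Geodesics as convex combinations *)

Lemma finite_subsets_filter (T : eqType) :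
  ProperFilter (filter_from [set: seq T] (fun s0 => [set s : seq T | {subset s0 <= s}])).
Proof.
apply: filter_from_proper; last by move=> s _; exists s => x.
apply: filter_from_filter; first by exists [::].
move=> s s' _ _; exists (s ++ s') => // u su; split=> x xs; apply: su;
  by rewrite mem_cat xs ?orbT.
Qed.

(** Were the length infinite, every [mu s] with 0 < s <= 1 would lie at infinite distance from
    [mu 0], against continuity at 0. *)
Lemma geodesic_length_fin_num (R : realType) (p : R) (q : \bar R) (mu : R -> diagram R) :
  geodesic p q mu -> exists2 d : R, 0 <= d & dist p q (mu 0) (mu 1) = d%:E.
Proof.
move=> [_ cont lin]; have := dist_ge0 p q (mu 0) (mu 1).
case dE : (dist p q (mu 0) (mu 1)) => [d| |]//; first by rewrite lee_fin; exists d.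
have z01 : 0 <= (0 : R) <= 1 by rewrite lexx ler01.
have n1 : nbhs (0%:E : \bar R) [set y | (y < 1%:E)%E].
  exact: (@nbhs_open_ereal_lt R 0 (fun=> 1) ltr01).
have /nbhs_ballP[e /= e0 he] := cont 0 z01 _ n1.
pose s := Num.min (e / 2) 1.
have s0 : 0 < s by rewrite lt_min ltr01 divr_gt0.
have s1 : s <= 1 by rewrite ge_min lexx orbT.
have s01 : 0 <= s <= 1 by rewrite (ltW s0).
have se : ball (0 : R) e s.
  rewrite /ball/= sub0r normrN gtr0_norm// gt_min; apply/orP; left.
  by rewrite ltr_pdivrMr// ltr_pMr// ltr1n.
have := he s se; rewrite /= in_itv/= s01 => /(_ isT).
by rewrite lin// dE sub0r normrN gtr0_norm// gt0_muley.
Qed.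

(* The index set of the ultrafilter is the directed set of finite sets of
   times, so that a single limit matching serves all times at once. *)
Lemma geodesic_optimal_convex_comb (R : realType) (p : R) (q : \bar R) (mu : R -> diagram R) :
  admissible p q -> geodesic p q mu ->
  exists2 phi, optimal p q (mu 0) (mu 1) phi &
    forall t, 0 < t < 1 -> is_convex_comb (mu 0) phi t (mu t).
Proof.
move=> adm geo; have p0 := admissible_gt0 adm.
have [d d0 dE] := geodesic_length_fin_num geo.
have [fin _ lin] := geo.
have lf t : 0 <= t <= 1 -> locally_finite (mu t).
  by move=> /fin; exact: finite_diagrams_locally_finite.
have dmu s t : 0 <= s <= 1 -> 0 <= t <= 1 -> dist p q (mu s) (mu t) = (`|t - s| * d)%:E.
  by move=> s01 t01; rewrite lin// dE.
have /choice[phi hphi] : forall T : seq R, exists phi,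
  [/\ set_bij (points (mu 0)) (points (mu 1)) phi,
    total_cost_le p q (mu 0) phi (d `^ p) &
    forall t, 0 < t < 1 -> t \in T -> exists psi, set_bij (points (mu 0)) (points (mu t)) psi /\
      forall x, points (mu 0) x -> (psi x).1 = convex_comb t x.1 (phi x).1].
  (* The chain of bijections requires strictly increasing interior times. *)
  move=> T; pose T' := sort <=%R (undup [seq t <- T | 0 < t < 1]).
  have T'E t : (t \in T') = (0 < t < 1) && (t \in T).
    by rewrite mem_sort mem_undup mem_filter.
  have pT' : path <%R 0 T'.
    rewrite path_min_sorted ?sort_lt_sorted ?undup_uniq//.
    by apply/allP => t; rewrite T'E => /andP[/andP[]].
  have [|phi [bij le hT]] := geodesic_finite_times adm d0 lf dmu pT' (lexx 0).
    rewrite /= ltr01; apply/allP => t; rewrite T'E => /andP[/andP[]//].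
  exists phi; split => //; first by rewrite subr0 mul1r in le.
  move=> t t01 tT; have [|psi bijp h] := hT t; first by rewrite T'E t01.
  exists psi; split => // x Ax; have := h x Ax.
  by rewrite !subr0 !mul1r /convex_comb => -[<- <-]; rewrite -surjective_pairing.
have /choice[psi hpsi] : forall T, exists psi : R -> ipoint R -> ipoint R,
    forall t, 0 < t < 1 -> t \in T ->
    set_bij (points (mu 0)) (points (mu t)) (psi t) /\
    forall x, points (mu 0) x -> (psi t x).1 = convex_comb t x.1 (phi T x).1.
  move=> T; have [_ _ h] := hphi T.
  have /choice[g hg] : forall t, exists psi : ipoint R -> ipoint R, 0 < t < 1 -> t \in T ->
      set_bij (points (mu 0)) (points (mu t)) psi /\
      forall x, points (mu 0) x -> (psi x).1 = convex_comb t x.1 (phi T x).1; last by exists g.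
  move=> t; have [t01|] := boolP (0 < t < 1); last by exists id.
  have [tT|] := boolP (t \in T); last by exists id.
  by have [g hg] := h t t01 tT; exists g.
(* Sequences stand for finite sets of times. For each fixed t, almost all T contain t, so [psi T t]
   has its defining property almost always when t is interior. *)
have [U [UU FU]] := ultraFilterLemma (finite_subsets_filter R).
have z01 : 0 <= (0 : R) <= 1 by rewrite lexx ler01.
have o01 : 0 <= (1 : R) <= 1 by rewrite lexx ler01.
have bij T : set_bij (points (mu 0)) (points (mu 1)) (phi T) by have [] := hphi T.
have [|phi0 [tr [bij0 lim]]] :=
  exists_limit_matching adm UU (lf _ z01) (lf _ o01) bij (K := d `^ p).
  by move=> T; have [] := hphi T.
exists phi0.
  split => //; apply/eqP; rewrite eq_le; apply/andP; split; last first.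
    by apply: ereal_inf_lbound; exists phi0.
  rewrite dE; apply/(cost_leP _ _ _ p0 d0).
  apply: (limit_matching_cost adm UU lim); apply: filterE => T.
  by have [] := hphi T.
move=> t t01; have t01' : 0 <= t <= 1 by case/andP: t01 => *; rewrite !ltW.
apply: (limit_convex_comb UU (lf _ z01) (lf _ o01) (lf _ t01') bij bij0 lim t01
  (psi := fun T => psi T t)).
apply: FU; exists [:: t] => // T /= tT; apply: hpsi => //.
by apply: tT; rewrite mem_head.
Qed.

Lemma dist_refl (R : realType) (p : R) (q : \bar R) (A : diagram R) :
  admissible p q -> dist p q A A = 0%E.
Proof.
move=> adm; have p0 := admissible_gt0 adm.
apply/eqP; rewrite eq_le dist_ge0 andbT.
apply: (dist_le (phi := id) p0 (lexx 0)); first by split=> [x|x y|x Ax] //; exists x.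
move=> s _ _; rewrite big1 ?powR_ge0// => x _.
by rewrite subrr gauge0.
Qed.

Theorem theorem11 (R : realType) (p : R) (q : \bar R)
  (hpq : (q = p%:E /\ 2 <= p) \/ (q = 2%:E /\ 1 < p))
  (X Y : diagram R)
  (hX : finite_diagrams p q X) (hY : finite_diagrams p q Y)
  (mu : R -> diagram R) (hmu : geodesic_from_to p q X Y mu) :
  exists2 gamma : R -> diagram R,
    convex_comb_geodesic p q X Y gamma &
    forall t : R, 0 <= t <= 1 -> dist p q (gamma t) (mu t) = 0%E.
Proof.
exists mu => [|t _]; last exact: dist_refl.
split => //; have [geo <- <-] := hmu.
exact: geodesic_optimal_convex_comb.
Qed.
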